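(* Let $M$ be a differentiable manifold, $D$ an $S$-derivation and $x_0\in M$. Then $D$ is at $x_0$ a linear connection if and only if there is a local basis $\{E_{i'}\}$ of vector fields, defined in a neighborhood of $x_0$, in which the components of $D$ along every vector field vanish at $x_0$.
   Context: $n=\dim M$; latin indices run from $1$ to $n$ and repeated indices on different levels are summed. $S$-derivation: let $S:X\mapsto S_X$ be a map (no linearity is assumed) from $C^1$ vector fields to tensor fields of type $(1,1)$. For each $X$ the formula $D_X=L_X+S_X$ defines a derivation of the tensor algebra over $M$, where $L_X$ is the Lie derivative along $X$ and $S_X$ acts as the algebraic derivation induced by the endomorphism field $S_X$ (so $S_X f=0$ on functions and $S_X Y=S_X(Y)$ on vector fields). The map $D:X\mapsto D_X$ is called an $S$-derivation. Components: in a local basis (frame) $\{E_i\}$ of $C^1$ vector fields (not necessarily a coordinate one), the components of $D_X$ are the functions $(W_X)^i_{.j}$ defined by $D_X(E_j)=(W_X)^i_{.j}E_i$; $W_X=[(W_X)^i_{.j}]$ is their matrix. $D$ is a linear connection at $x_0$ if in some, and hence any, local basis $\{E_i\}$ around $x_0$ there are constant matrices $\Gamma_1,\dots,\Gamma_n$ such that $W_X(x_0)=\Gamma_kX^k(x_0)$ for every vector field $X=X^kE_k$ (no condition is imposed at points $x\neq x_0$). *)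

(* Defs.v *)
From HB Require Import structures.
From mathcomp Require Import all_boot all_order all_algebra.
From mathcomp Require Import all_classical all_reals all_analysis.

Set Implicit Arguments.
Unset Strict Implicit.
Unset Printing Implicit Defensive.

Import Order.TTheory GRing.Theory Num.Theory.
Import numFieldNormedType.Exports.

Local Open Scope classical_set_scope.
Local Open Scope ring_scope.

(* Class C^k on a set; only meaningful, and only used, for open A. *)
Fixpoint Ck (R : realType) (m n : nat) (k : nat) (A : set 'rV[R]_m)
    (f : 'rV[R]_m -> 'rV[R]_n) : Prop :=
  if k is k'.+1 then
    (forall y, A y -> differentiable f y) /\ (forall v, Ck k' A ('D_v f))
  else forall y, A y -> {for y, continuous f}.

(* A homeomorphism from an open subset of M onto an open subset of R^n and its
   inverse; the values of both maps outside these sets are irrelevant. *)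
Record chart (R : realType) (n : nat) (M : topologicalType) := Chart {
  chart_dom : set M;
  chart_coord : M -> 'rV[R]_n;
  chart_param : 'rV[R]_n -> M;
  dom_open : open chart_dom;
  codom_open : open (chart_coord @` chart_dom);
  coordK : forall x, chart_dom x -> chart_param (chart_coord x) = x;
  coord_continuous : forall x, chart_dom x -> {for x, continuous chart_coord};
  param_continuous :
    forall y, (chart_coord @` chart_dom) y -> {for y, continuous chart_param} }.

(* C^2 is the least regularity for which C^1 vector fields make sense; an atlas
   of class C^r with 2 <= r <= oo is in particular of class C^2, and it has the
   same C^1 vector fields.  The atlas need not be maximal. *)
Record manifold (R : realType) (n : nat) := Manifold {
  carrier :> topologicalType;
  carrier_hausdorff : hausdorff_space carrier;
  chart_index : Type;
  atlas : chart_index -> chart R n carrier;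
  atlas_cover : forall x, exists i, chart_dom (atlas i) x;
  atlas_compat : forall i j,
    Ck 2 (chart_coord (atlas i) @` (chart_dom (atlas i) `&` chart_dom (atlas j)))
         (chart_coord (atlas j) \o chart_param (atlas i)) }.

Lemma diff_near_comp (R : realType) (U V W : normedModType R) (f : U -> V)
    (g : V -> W) (h : U -> W) (a v : U) (b : V) :
  f a = b -> (\near a, h a = g (f a)) ->
  differentiable f a -> differentiable g b -> differentiable h a ->
  'd h a v = 'd g b ('d f a v).
Proof.
move=> <- hgf df dg dh.
have dgf : differentiable (g \o f) a by exact: differentiable_comp.
have := congr1 (fun F => F v) (diff_comp df dg) => /= <-.
transitivity ('D_v h a); first by rewrite deriveE.
transitivity ('D_v (g \o f) a); last by rewrite deriveE.
exact: near_eq_derive.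
Qed.

Section Tangent.
Variables (R : realType) (n : nat) (M : manifold R n).
Local Notation dom i := (chart_dom (atlas (m := M) i)).
Local Notation coord i := (chart_coord (atlas (m := M) i)).
Local Notation param i := (chart_param (atlas (m := M) i)).

Definition transition (i j : chart_index M) : 'rV[R]_n -> 'rV[R]_n :=
  coord j \o param i.

(* A tangent vector at x is the family of its components in the charts around
   x, related by the Jacobians of the transition maps; the entries for the
   other charts are set to 0 so that each vector has a single representation. *)
Definition tangent_family (x : M) : {pred chart_index M -> 'rV[R]_n} :=
  [pred v | `[< (forall i, ~ dom i x -> v i = 0) /\
     (forall i j, dom i x -> dom j x ->
        v j = 'd (transition i j) (coord i x) (v i)) >]].

Lemma tangent_family_submod_closed (x : M) :
  submod_closed (tangent_family x).
Proof.
split.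
  by apply/asboolP; split=> // i j _ _; rewrite linear0.
move=> a u v /asboolP[u0 uE] /asboolP[v0 vE]; apply/asboolP; split.
  by move=> i xi; rewrite !fctE u0// v0// scaler0 addr0.
by move=> i j xi xj; rewrite !fctE (uE i j)// (vE i j)// linearP.
Qed.

HB.instance Definition _ (x : M) :=
  GRing.isSubmodClosed.Build R _ (tangent_family x)
    (tangent_family_submod_closed x).

Record tangent (x : M) := Tangent {
  tangent_comp :> chart_index M -> 'rV[R]_n;
  tangent_compP : tangent_comp \in tangent_family x }.

HB.instance Definition _ (x : M) := [isSub for @tangent_comp x].
HB.instance Definition _ (x : M) := [Choice of tangent x by <:].
HB.instance Definition _ (x : M) :=
  [SubChoice_isSubLmodule of tangent x by <:].

Lemma tangent_of_proof (x : M) (i : chart_index M) (v : 'rV[R]_n) : dom i x ->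
  (fun j => if `[< dom j x >] then 'd (transition i j) (coord i x) v else 0)
    \in tangent_family x.
Proof.
move=> xi; apply/asboolP; split=> [j xj|j k xj xk]; first by rewrite asboolF.
rewrite !asboolT//.
have tdiff i' j' : dom i' x -> dom j' x ->
    differentiable (transition i' j') (coord i' x).
  by move=> xi' xj'; apply: (proj1 (@atlas_compat _ _ M i' j')); exists x.
have tx : transition i j (coord i x) = coord j x by rewrite /transition/= coordK.
apply: diff_near_comp tx _ (tdiff i j xi xj) (tdiff j k xj xk) (tdiff i k xi xk).
have ci : \forall y \near coord i x, dom j (param i y).
  apply: (@param_continuous _ _ _ (atlas i)); first by exists x.
  by rewrite coordK//; apply: open_nbhs_nbhs; split=> //; exact: dom_open.
by apply: filterS ci => y yj; rewrite /transition/= coordK.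
Qed.

(* The tangent vector at x with components v in the chart i. *)
Definition tangent_of (x : M) (i : chart_index M) (xi : dom i x) (v : 'rV[R]_n) :
  tangent x := Tangent (tangent_of_proof v xi).

Definition section := forall x : M, tangent x.

Definition local_rep (i : chart_index M) (X : section) : 'rV[R]_n -> 'rV[R]_n :=
  fun y => X (param i y) i.

Definition C1_on (U : set M) (X : section) : Prop :=
  forall i, Ck 1 (coord i @` (dom i `&` U)) (local_rep i X).

Record vector_field := VectorField {
  field_section :> forall x : M, tangent x;
  field_C1 : C1_on setT field_section }.

Definition tensor11 := forall x : M, {linear tangent x -> tangent x}.

(* L_X Y = X^b d_b Y - Y^b d_b X, computed in some chart around x: for X and Y
   of class C^1 near x the result is the same in all of them. *)
Definition lie (X Y : section) : section := fun x =>
  let: exist i xi := cid (atlas_cover x) in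
  tangent_of xi ('D_(X x i) (local_rep i Y) (coord i x) -
                 'D_(Y x i) (local_rep i X) (coord i x)).

(* The action of D_X on vector fields, possibly only defined locally. As a
   derivation of the tensor algebra commuting with contractions, D_X is
   determined by S_X, which is why S itself stands for the S-derivation. *)
Definition Sderivation (S : vector_field -> tensor11) (X : vector_field)
  (Y : section) : section := fun x => lie X Y x + S X x (Y x).

Definition is_basis (x : M) (e : 'I_n -> tangent x) : Prop :=
  forall v, exists! c : 'rV[R]_n, v = \sum_k c 0 k *: e k.

Definition basis_coord (x : M) (e : 'I_n -> tangent x) (v : tangent x) :
  'rV[R]_n := xget 0 [set c : 'rV[R]_n | v = \sum_k c 0 k *: e k].

(* The values of E outside U are irrelevant. *)
Definition local_basis (U : set M) (E : 'I_n -> section) : Prop :=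
  [/\ open U, forall j, C1_on U (E j)
    & forall x, U x -> is_basis (E^~ x)].

(* (W_X)^i_j (x): row index i, column index j. *)
Definition components (S : vector_field -> tensor11) (E : 'I_n -> section)
  (X : vector_field) (x : M) : 'M[R]_n :=
  \matrix_(i, j) basis_coord (E^~ x) (Sderivation S X (E j) x) 0 i.

(* If the condition holds in one local basis around x0, it holds in all of them,
   with other matrices Gamma. *)
Definition linear_connection_at (S : vector_field -> tensor11) (x0 : M) :
    Prop :=
  exists (U : set M) (E : 'I_n -> section),
    [/\ U x0, local_basis U E
      & exists Gamma : 'I_n -> 'M[R]_n, forall X : vector_field,
          components S E X x0 =
          \sum_k basis_coord (E^~ x0) (X x0) 0 k *: Gamma k].

End Tangent.

(* Main.v *)
From HB Require Import structures.
Require Import Defs.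
From mathcomp Require Import all_boot all_order all_algebra perm.
From mathcomp Require Import all_classical all_reals all_analysis.

Set Implicit Arguments.
Unset Strict Implicit.
Unset Printing Implicit Defensive.

Import Order.TTheory GRing.Theory Num.Theory.
Import numFieldNormedType.Exports.

Local Open Scope classical_set_scope.
Local Open Scope ring_scope.

(** A vanishing of all components at [x0] is the connection condition with zero
matrices, so only the construction of the basis is at stake.  Let
[W_X(x0) = Gamma_k X^k(x0)] in a basis [E] and look for
[E'_j = A^l_j E_l] with [A(x0) = 1].  The Leibniz rule for the Lie derivative
gives, at [x0],

  [D_X E'_j = X(A^l_j) E_l + A^l_j D_X E_l = (X(A) + W_X)^l_j E_l],

because [S_X] is linear over functions and so only sees [E'_j(x0) = E_j(x0)]
([lie_frame_change]).  The new components thus vanish at [x0] for every [X] as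
soon as the differential of [A] at [x0] is [v |-> - Gamma_k v^k].  This is a
condition at one point on a linear map of the tangent space, so no
integrability condition appears: an [A] that is affine in the coordinates of a
chart meets it, and it stays invertible near [x0] by continuity of the
determinant ([exists_frame_change]).  It is here that the hypothesis is used:
the values [W_X(x0)] have to depend linearly on [X(x0)] alone.

What remains is regularity.  The entries of [A], read in another chart, are
affine functions of a transition map, which is of class C^2, so they are of
class C^1; sums and products of C^1 maps are C^1, hence so are the [E'_j]
([local_basis_frame_change]). *)

(** * Maps of class C^1 between normed spaces *)

Section C1.
Variable R : realType.

(** [Ck 1] freed from row vectors, so that it also covers the scalar
coefficients of a change of basis. *)
Definition C1 (V W : normedModType R) (A : set V) (f : V -> W) : Prop :=
  (forall y, A y -> differentiable f y) /\
  (forall v y, A y -> {for y, continuous ('D_v f)}).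

Lemma C1E m n (A : set 'rV[R]_m) (f : 'rV[R]_m -> 'rV[R]_n) :
  Ck 1 A f <-> C1 A f.
Proof. by []. Qed.

Lemma Ck2_C1 m n (A : set 'rV[R]_m) (f : 'rV[R]_m -> 'rV[R]_n) :
  Ck 2 A f -> C1 A f.
Proof.
move=> [df Df]; split=> // v y Ay.
by have [dDf _] := Df v; exact/differentiable_continuous/dDf.
Qed.

Lemma C1_sub (V W : normedModType R) (A B : set V) (f : V -> W) :
  A `<=` B -> C1 B f -> C1 A f.
Proof.
by move=> AB [df Df]; split=> [y /AB|v y /AB]; [exact: df|exact: Df].
Qed.

Lemma near_eq_continuous (T U : topologicalType) (f g : T -> U) (y : T) :
  (\forall z \near y, f z = g z) -> {for y, continuous f} ->
  {for y, continuous g}.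
Proof.
move=> fg; rewrite /prop_for /continuous_at.
have /= <- := nbhs_singleton fg => fy.
exact: cvg_trans (near_eq_cvg fg) fy.
Qed.

Lemma open_near (V : topologicalType) (A P : set V) y :
  open A -> A y -> A `<=` P -> \forall z \near y, P z.
Proof.
by move=> oA Ay AP; apply: filterS AP _; apply: open_nbhs_nbhs; split.
Qed.

(** Scaling is a continuous bilinear map, and it is here composed with the pair
[(a, f)]. *)
Lemma deriv_scale (V W : normedModType R) (a : V -> R) (f : V -> W) y v :
  differentiable a y -> differentiable f y ->
  differentiable (fun z => a z *: f z) y /\
  'D_v (fun z => a z *: f z) y = 'D_v a y *: f y + a y *: 'D_v f y.
Proof.
move=> da df.
have bil : bilinear_for
    (GRing.Scale.Law.clone _ _ *:%R _) (GRing.Scale.Law.clone _ _ *:%R _)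
    (@GRing.scale R W : R -> W -> W).
  split=> [u'|u] c x z /=; first by rewrite scalerDl scalerA.
  by rewrite scalerDr !scalerA mulrC.
pose bilM := bilinear_isBilinear.Build R R W W _ _ (@GRing.scale R W : R -> W -> W) bil.
pose B : {bilinear R -> W -> W} :=
  HB.pack (@GRing.scale R W : R -> W -> W) bilM.
have cB : continuous (fun p : R * W => B p.1 p.2) by exact: scale_continuous.
have dB := differentiable_bilin (a y, f y) cB.
have dp : differentiable (fun z => (a z, f z)) y by exact: differentiable_pair.
have E : (fun z => a z *: f z) = (fun p : R * W => B p.1 p.2) \o (fun z => (a z, f z)).
  by [].
have dE : differentiable (fun z => a z *: f z) y.
  by rewrite E; exact: differentiable_comp.
split => //.
rewrite deriveE// [in LHS]E diff_comp// diff_bilin//= diff_pair//=.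
by rewrite !deriveE// addrC.
Qed.

(** Openness of [A] matters: the Leibniz formula for [z |-> 'D_v (a *: f) z] is
known only on [A], and it must hold near [y] to give continuity at [y].  The same
remark applies to sums and to affine maps. *)
Lemma C1_scale (V W : normedModType R) (A : set V) (a : V -> R) (f : V -> W) :
  open A -> C1 A a -> C1 A f -> C1 A (fun z => a z *: f z).
Proof.
move=> oA [da Da] [df Df]; split=> [y Ay|v y Ay].
  by have [] := deriv_scale 0 (da _ Ay) (df _ Ay).
apply: (@near_eq_continuous _ _ (fun z => 'D_v a z *: f z + a z *: 'D_v f z)).
  apply: (open_near oA Ay) => z Az.
  by have [] := deriv_scale v (da _ Az) (df _ Az).
apply: cvgD; apply: cvgZ; by
  [exact: Da|exact: Df|exact: differentiable_continuous (da _ Ay)|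
   exact: differentiable_continuous (df _ Ay)].
Qed.

Lemma C1_cst (V W : normedModType R) (A : set V) (b : W) : C1 A (cst b).
Proof.
split=> [y _|v y _]; first exact: differentiable_cst.
rewrite (_ : 'D_v _ = cst 0); first exact: cst_continuous.
by apply/funext => z; rewrite derive_cst.
Qed.

Lemma C1_add (V W : normedModType R) (A : set V) (f g : V -> W) :
  open A -> C1 A f -> C1 A g -> C1 A (fun z => f z + g z).
Proof.
move=> oA [df Df] [dg Dg]; split=> [y Ay|v y Ay].
  by apply: differentiableD; [exact: df|exact: dg].
apply: (@near_eq_continuous _ _ (fun z => 'D_v f z + 'D_v g z)).
  apply: (open_near oA Ay) => z Az; rewrite deriveD//; apply: diff_derivable.
    exact: df.
  exact: dg.
by apply: cvgD; [exact: Df|exact: Dg].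
Qed.

Lemma C1_sum (V W : normedModType R) (A : set V) I (r : seq I) (f : I -> V -> W) :
  open A -> (forall i, C1 A (f i)) -> C1 A (fun z => \sum_(i <- r) f i z).
Proof.
move=> oA Cf; elim: r => [|i r IHr].
  rewrite (_ : (fun _ => _) = cst 0); first exact: C1_cst.
  by apply/funext => z; rewrite big_nil.
rewrite (_ : (fun _ => _) = (fun z => f i z + \sum_(i <- r) f i z)).
  exact: C1_add.
by apply/funext => z; rewrite big_cons.
Qed.

Lemma linear_rV_continuous n (W : normedModType R) (L : {linear 'rV[R]_n -> W}) :
  continuous L.
Proof.
have -> : (L : _ -> _) = \sum_(j < n) (fun w : 'rV[R]_n => w 0 j *: L (delta_mx 0 j)).
  apply/funext => w; rewrite fct_sumE [in LHS](row_sum_delta w) linear_sum.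
  by apply: eq_bigr => j _; rewrite linearZ.
move=> w; apply: differentiable_continuous; apply: differentiable_sum => j.
exact/differentiableZl/differentiable_coord.
Qed.

Lemma deriv_affine (V W Z : normedModType R) (L : {linear W -> Z}) (b : Z)
    (f : V -> W) y v :
  continuous L -> differentiable f y ->
  differentiable (fun z => b + L (f z)) y /\
  'D_v (fun z => b + L (f z)) y = L ('D_v f y).
Proof.
move=> cL df.
have dL : differentiable L (f y) by exact: linear_differentiable.
have dLf : differentiable (L \o f) y by exact: differentiable_comp.
split.
  by apply: (@differentiableD _ _ _ (cst b) (L \o f)) => //; exact: differentiable_cst.
rewrite (@deriveD _ _ _ (cst b) (L \o f)); [|exact: derivable_cst|exact: diff_derivable].
by rewrite derive_cst add0r !deriveE// diff_comp//= diff_lin.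
Qed.

Lemma C1_affine (V W Z : normedModType R) (A : set V) (L : {linear W -> Z}) (b : Z)
    (f : V -> W) :
  open A -> continuous L -> C1 A f -> C1 A (fun z => b + L (f z)).
Proof.
move=> oA cL [df Df]; split=> [y Ay|v y Ay].
  by have [] := deriv_affine b 0 cL (df _ Ay).
apply: (@near_eq_continuous _ _ (L \o 'D_v f)).
  by apply: (open_near oA Ay) => z Az /=; have [_ ->] := deriv_affine b v cL (df _ Az).
by apply: continuous_comp; [exact: Df|exact: cL].
Qed.

(** * Continuity of the determinant *)

Lemma continuous_bigop (T U : topologicalType) (op : U -> U -> U) (x0 : U) I
    (r : seq I) (f : I -> T -> U) :
  (forall g h : T -> U, continuous g -> continuous h ->
    continuous (fun z => op (g z) (h z))) ->
  (forall i, continuous (f i)) ->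
  continuous (fun z => \big[op/x0]_(i <- r) f i z).
Proof.
move=> opc fc; elim: r => [|i r IHr].
  rewrite (_ : (fun _ => _) = cst x0); first exact: cst_continuous.
  by apply/funext => z; rewrite big_nil.
rewrite (_ : (fun _ => _) = (fun z => op (f i z) (\big[op/x0]_(j <- r) f j z))).
  exact: opc.
by apply/funext => z; rewrite big_cons.
Qed.

Lemma continuous_det n : continuous (fun B : 'M[R]_n => \det B).
Proof.
rewrite /determinant; apply: continuous_bigop => [g h cg ch z|s].
  exact: (cvgD (cg z) (ch z)).
have cp : continuous (fun B : 'M[R]_n => \prod_(i < n) B i ((s : {perm 'I_n}) i)).
  apply: continuous_bigop => [g h cg ch z|i].
    exact: (cvgM (cg z) (ch z)).
  exact: coord_continuous.
by move=> B; exact: (cvgM (cvg_cst _) (cp B)).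
Qed.
End C1.

(** * Tangent vectors and their coordinates in a basis *)

Section Geometry.
Variables (R : realType) (n : nat) (M : manifold R n).
Implicit Types (x : M) (i : chart_index M) (E : 'I_n -> section M).
Local Notation dom i := (chart_dom (atlas (m := M) i)).
Local Notation coord i := (chart_coord (atlas (m := M) i)).
Local Notation param i := (chart_param (atlas (m := M) i)).

Lemma tangent_comp_sum x I (r : seq I) (v : I -> tangent x) i :
  (\sum_(k <- r) v k) i = \sum_(k <- r) v k i.
Proof. exact: (big_morph (fun w : tangent x => w i)). Qed.

Lemma tangent_ofK x i (xi : dom i x) (u : tangent x) :
  tangent_of xi (u i) = u.
Proof.
apply: val_inj; apply/funext => j /=.
have /asboolP[u0 uE] := tangent_compP u.
have [xj|xj] := pselect (dom j x).
  by rewrite asboolT// (uE i j).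
by rewrite asboolF// u0.
Qed.

Lemma tangent_of_linear x i (xi : dom i x) : linear (tangent_of xi).
Proof.
move=> c u v; apply: val_inj; apply/funext => j /=.
rewrite !fctE; case: ifP => _; first exact: linearP.
by rewrite scaler0 addr0.
Qed.

HB.instance Definition _ x i (xi : dom i x) :=
  GRing.isLinear.Build R 'rV[R]_n (tangent x) *:%R (tangent_of xi)
    (tangent_of_linear xi).

Section Basis.
Variables (x : M) (e : 'I_n -> tangent x) (be : is_basis e).

Lemma basis_coordE v : v = \sum_k basis_coord e v 0 k *: e k.
Proof.
have [c [cv _]] := be v.
exact: (@xgetPex _ 0 [set c : 'rV[R]_n | v = \sum_k c 0 k *: e k]
  (ex_intro _ c cv)).
Qed.

Lemma basis_coord_unique v (c : 'rV[R]_n) : v = \sum_k c 0 k *: e k -> basis_coord e v = c.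
Proof.
move=> vc; have [d [_ d_unique]] := be v.
by rewrite -(d_unique _ (basis_coordE v)) -(d_unique _ vc).
Qed.

Lemma basis_coord_linear : linear (basis_coord e).
Proof.
move=> a u v; apply: basis_coord_unique.
rewrite [in LHS](basis_coordE u) [in LHS](basis_coordE v) scaler_sumr -big_split/=.
by apply: eq_bigr => k _; rewrite !mxE scalerDl scalerA.
Qed.

End Basis.

(** * Change of basis *)

Lemma image_open i (U : set M) : open U -> open (coord i @` (dom i `&` U)).
Proof.
move=> oU; rewrite openE => y [x [xi Ux] <-].
have pc : {for coord i x, continuous (param i)}.
  by apply: (@param_continuous _ _ _ (atlas i)); exists x.
have nc : \forall y \near coord i x, (coord i @` dom i) y.
  by apply: open_nbhs_nbhs; split; [exact: codom_open|exists x].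
have nU : \forall y \near coord i x, U (param i y).
  by apply: pc; rewrite coordK//; apply: open_nbhs_nbhs; split.
apply: filterS2 nc nU => _ [z zi <-].
by rewrite coordK// => Uz; exists z.
Qed.

Definition C1_coef (U : set M) (a : M -> R) : Prop :=
  forall i, C1 (coord i @` (dom i `&` U)) (a \o param i).

Definition frame_change (A : M -> 'M[R]_n) E (j : 'I_n) : section M :=
  fun x => \sum_l A x l j *: E l x.

(** The combination of the new vectors with coefficients [c] is the combination
of the old ones with coefficients [c *m B^T], and [B^T] is invertible. *)
Lemma frame_change_basis x (B : 'M[R]_n) (e : 'I_n -> tangent x) :
  B \in unitmx -> is_basis e -> is_basis (fun j => \sum_l B l j *: e l).
Proof.
move=> uB be v.
have comb (c : 'rV[R]_n) : \sum_k c 0 k *: (\sum_l B l k *: e l) =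
    \sum_l (c *m B^T) 0 l *: e l.
  under eq_bigr do rewrite scaler_sumr.
  rewrite exchange_big; apply: eq_bigr => l _.
  by rewrite mxE scaler_suml; apply: eq_bigr => k _; rewrite scalerA mxE.
have uBT : B^T \in unitmx by rewrite unitmx_tr.
exists (basis_coord e v *m invmx B^T); split.
  by rewrite comb mulmxKV//; exact: basis_coordE.
move=> c; rewrite comb => /(basis_coord_unique be) ->.
by rewrite mulmxK.
Qed.

Lemma local_basis_frame_change (U : set M) E (A : M -> 'M[R]_n) :
  local_basis U E -> (forall l j, C1_coef U (fun x => A x l j)) ->
  (forall x, U x -> A x \in unitmx) -> local_basis U (frame_change A E).
Proof.
move=> [oU CE bE] CA uA; split=> // [j i|x Ux].
  rewrite C1E.
  have -> : local_rep i (frame_change A E j) =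
      (fun y => \sum_l A (param i y) l j *: local_rep i (E l) y).
    by apply/funext => y; rewrite /local_rep /frame_change tangent_comp_sum.
  apply: C1_sum => [|l]; first exact: image_open.
  apply: C1_scale; [exact: image_open|exact: CA|exact/C1E/CE].
by apply: frame_change_basis; [exact: uA|exact: bE].
Qed.

Lemma local_basis_sub (U V : set M) E :
  open V -> V `<=` U -> local_basis U E -> local_basis V E.
Proof.
move=> oV VU [oU CE bE]; split=> // [j i|x /VU]; last exact: bE.
have /C1E CEi := CE j i; apply/C1E; apply: C1_sub CEi => y [x [xi Vx] <-].
by exists x => //; split => //; exact: VU.
Qed.

Lemma sum_scalar_mx1 (V : lmodType R) (e : 'I_n -> V) j :
  \sum_l (1%:M : 'M[R]_n) l j *: e l = e j.
Proof.
rewrite (bigD1 j)//= big1 ?addr0 => [|l lj]; first by rewrite mxE eqxx scale1r.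
by rewrite mxE (negbTE lj) scale0r.
Qed.

(** * The Lie derivative of a changed basis *)

(** The chart in which [lie] computes at [x]. *)
Definition lie_chart x : chart_index M := sval (cid (atlas_cover x)).

Lemma lie_chart_dom x : dom (lie_chart x) x.
Proof. exact: (svalP (cid (atlas_cover x))). Qed.

Lemma lieE (X Y : section M) x (i := lie_chart x) :
  lie X Y x = tangent_of (lie_chart_dom x)
    ('D_(X x i) (local_rep i Y) (coord i x) -
     'D_(Y x i) (local_rep i X) (coord i x)).
Proof.
move: (lie_chart_dom x); rewrite /i /lie /lie_chart.
by case: (cid _) => /= k xk xk'; congr tangent_of; exact: Prop_irrelevance.
Qed.

(** [L_X (A^l_j E_l) = X(A^l_j) E_l + A^l_j L_X E_l] at a point where
[A = 1].  In [[X, Y] = 'D_X Y - 'D_Y X] only the first term differentiates the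
coefficients; the second sees only the values at [x], where the two bases
agree. *)
Lemma lie_frame_change (X : section M) (U : set M) E (A : M -> 'M[R]_n) x j
    (i := lie_chart x) : U x -> local_basis U E ->
  (forall l k, C1_coef U (fun x => A x l k)) -> A x = 1%:M ->
  lie X (frame_change A E j) x = lie X (E j) x +
    \sum_l 'D_(X x i) (fun y => A (param i y) l j) (coord i x) *: E l x.
Proof.
move=> Ux [oU CE bE] CA A1.
have Ey : frame_change A E j x = E j x.
  by rewrite /frame_change A1 sum_scalar_mx1.
have xi := lie_chart_dom x; rewrite -/i in xi.
have iU : (coord i @` (dom i `&` U)) (coord i x) by exists x.
have dA l : differentiable (fun y => A (param i y) l j) (coord i x).
  by have [dA _] := CA l j i; exact: dA.
have dE l : differentiable (local_rep i (E l)) (coord i x).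
  by have /C1E[dE _] := CE l i; exact: dE.
have -> : \sum_l 'D_(X x i) (fun y => A (param i y) l j) (coord i x) *: E l x =
    tangent_of (lie_chart_dom x)
     (\sum_l 'D_(X x i) (fun y => A (param i y) l j) (coord i x) *: E l x i).
  rewrite linear_sum; apply: eq_bigr => l _.
  by rewrite linearZ/= tangent_ofK.
rewrite !lieE Ey -linearD addrAC -/i; congr (tangent_of _ (_ - _)).
have -> : local_rep i (frame_change A E j) =
    \sum_l (fun y => A (param i y) l j *: local_rep i (E l) y).
  by apply/funext => y; rewrite /local_rep /frame_change tangent_comp_sum fct_sumE.
rewrite derive_sum => [|l]; last first.
  by apply: diff_derivable; have [] := deriv_scale 0 (dA l) (dE l).
under eq_bigr => l _ do
  rewrite (proj2 (deriv_scale (X x i) (dA l) (dE l))) /local_rep coordK// A1.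
by rewrite big_split/= sum_scalar_mx1 addrC.
Qed.

(** * Coefficients with a prescribed differential *)

(** In the chart [i], [A = 1 + L (y - y0)] where [y0] is the coordinate vector of
[x0].  Away from [x0], only the neighbourhood [V] on which [A] is invertible and
the chart is defined is kept. *)
Lemma exists_frame_change (x0 : M) (U : set M) (L : {linear tangent x0 -> 'M[R]_n})
    (i := lie_chart x0) : open U -> U x0 ->
  exists (V : set M) (A : M -> 'M[R]_n),
    [/\ open V, V x0, V `<=` U & [/\ A x0 = 1%:M,
      forall x, V x -> A x \in unitmx,
      forall l j, C1_coef V (fun x => A x l j)
    & forall (v : tangent x0) l j,
        'D_(v i) (fun y => A (param i y) l j) (coord i x0) = L v l j]].
Proof.
move=> oU Ux0; have xi : dom i x0 := lie_chart_dom x0.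
pose L' : {linear 'rV[R]_n -> 'M[R]_n} := L \o tangent_of xi.
pose B0 := 1%:M - L' (coord i x0).
pose A x := B0 + L' (coord i x).
have A1 : A x0 = 1%:M by rewrite /A /B0 subrK.
have linL l j : linear (fun w : 'rV[R]_n => L' w l j : R).
  by move=> c u v; rewrite linearP !mxE.
pose Llj l j : {linear 'rV[R]_n -> R} :=
  HB.pack (fun w : 'rV[R]_n => L' w l j : R)
    (GRing.isLinear.Build _ _ _ _ _ (linL l j)).
have Aentry l j x : A x l j = B0 l j + Llj l j (coord i x) by rewrite mxE.
have unear : \forall x \near x0, A x \in unitmx.
  have cA : {for x0, continuous A}.
    apply: (@continuousD _ _ _ (cst B0) (L' \o coord i)).
      exact: cst_continuous.
    apply: continuous_comp; last exact: linear_rV_continuous.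
    exact: Defs.coord_continuous.
  have cd : {for x0, continuous (fun x => \det (A x))}.
    by apply: continuous_comp cA _; exact: continuous_det.
  have : \forall x \near x0, \det (A x) != 0.
    by apply: (cvgr_neq0 _ cd); rewrite A1 det1 oner_neq0.
  by apply: filterS => x; rewrite unitmxE unitfE.
pose V := interior [set x | [/\ U x, dom i x & A x \in unitmx]].
have VP x : V x -> [/\ U x, dom i x & A x \in unitmx] by exact: interior_subset.
exists V, A; split; [exact: open_interior| |by move=> x /VP[]|split=> //].
- rewrite /V /interior/=; near=> x; split; near: x => //.
  + by apply: open_nbhs_nbhs; split.
  + by apply: open_nbhs_nbhs; split => //; exact: dom_open.
- by move=> x /VP[].
- move=> l j k.
  (* In the chart [k], [A] is affine in a transition map, and that map is C^2. *)
  have -> : (fun x => A x l j) \o param k =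
      (fun y => B0 l j + Llj l j (transition k i y)).
    by apply/funext => y; rewrite /= Aentry.
  apply: C1_affine.
  + by apply: image_open; exact: open_interior.
  + exact: linear_rV_continuous.
  + apply: C1_sub (Ck2_C1 (@atlas_compat _ _ M k i)).
    by move=> _ [x [xk /VP[_ xi' _]] <-]; exists x.
- move=> v l j.
  (* [coord i \o param i] is the identity near the coordinates of [x0], but
     possibly not elsewhere. *)
  rewrite (@near_eq_derive _ _ _ _ (fun y => B0 l j + Llj l j (id y))).
    rewrite (proj2 (deriv_affine _ _ (@linear_rV_continuous _ _ _ _) _)).
      by rewrite derive_id /= tangent_ofK.
    exact: ex_diff.
  have : \forall y \near coord i x0, (coord i @` dom i) y.
    by apply: open_nbhs_nbhs; split; [exact: codom_open|exists x0].
  by apply: filterS => _ [x xd <-]; rewrite Aentry coordK.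
Unshelve. all: by end_near. Qed.

End Geometry.

(** * Bases in which the components vanish *)

Theorem proposition10 (R : realType) (n : nat) (M : manifold R n)
    (S : vector_field M -> tensor11 M) (x0 : M) :
  linear_connection_at S x0 <->
  exists (U : set M) (E : 'I_n -> section M),
    [/\ U x0, local_basis U E
      & forall X : vector_field M, components S E X x0 = 0%R].
Proof.
split=> [[U [E [Ux0 bE [Gamma WE]]]]|[U [E [Ux0 bE W0]]]]; last first.
  exists U, E; split=> //; exists (fun _ => 0) => X.
  by rewrite W0 big1// => k _; rewrite scaler0.
have [oU CE isb] := bE; have {isb} be := isb _ Ux0.
(* The differential that the coefficients must have at [x0] in order to cancel
   [W_X(x0)]. *)
pose minusGamma (v : tangent x0) : 'M[R]_n :=
  - \sum_k basis_coord (E^~ x0) v 0 k *: Gamma k.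
have linL : linear minusGamma.
  move=> c u v; rewrite /minusGamma (basis_coord_linear be) scalerN -opprD scaler_sumr -big_split/=.
  by congr (- _); apply: eq_bigr => k _; rewrite !mxE scalerDl scalerA.
pose L : {linear tangent x0 -> 'M[R]_n} :=
  HB.pack minusGamma (GRing.isLinear.Build _ _ _ _ _ linL).
have [V [A [oV Vx0 VU [A1 uA CA DA]]]] := exists_frame_change L oU Ux0.
have bEV := local_basis_sub oV VU bE.
exists V, (frame_change A E); split=> //.
  exact: local_basis_frame_change.
move=> X.
(* The bases agree at [x0], so the components are taken in the same one. *)
have Ex0 : (frame_change A E)^~ x0 = E^~ x0.
  by apply/funext => j; rewrite /frame_change A1 sum_scalar_mx1.
apply/matrixP => l j; rewrite [LHS]mxE [RHS]mxE Ex0.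
have -> : Sderivation S X (frame_change A E j) x0 =
    Sderivation S X (E j) x0 + \sum_l L (X x0) l j *: E l x0.
  rewrite /Sderivation (lie_frame_change _ _ Vx0 bEV CA A1).
  have -> : frame_change A E j x0 = E j x0 by exact: (congr1 (@^~ j) Ex0).
  by rewrite addrAC; congr (_ + _); apply: eq_bigr => l' _; rewrite DA.
have -> : \sum_l0 L (X x0) l0 j *: E l0 x0 =
    \sum_l0 (\row_k L (X x0) k j) 0 l0 *: E l0 x0.
  by apply: eq_bigr => l0 _; rewrite mxE.
have := congr1 (fun B : 'M[R]_n => B l j) (WE X); rewrite /= [LHS]mxE => Wlj.
rewrite -[Sderivation _ _ _ _]scale1r basis_coord_linear// mxE mxE Wlj.
by rewrite (basis_coord_unique be erefl) !mxE mul1r subrr.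
Qed.
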